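(* Let $(\mathsf X,d)$ be a Polish space and let $\phi:\mathscr P_1(\mathsf X)\to\bar{\mathbb R}$ be a proper convex function on $(\mathscr P_1(\mathsf X),W_1)$, i.e. $\phi$ is convex and lower semicontinuous with respect to $W_1$, $\phi(\mu)>-\infty$ for all $\mu\in\mathscr P_1(\mathsf X)$, and $\phi(\mu_0)\in\mathbb R$ for some $\mu_0\in\mathscr P_1(\mathsf X)$. Define $$\rho(f):=\sup_{\mu\in\mathscr P_1(\mathsf X)}\Big(\int f\,d\mu-\phi(\mu)\Big),\quad f\in\mathscr L(\mathsf X),\qquad \phi^c(\mu):=\sup_{f\in\mathscr L(\mathsf X)}\Big(\int f\,d\mu-\rho(f)\Big),\quad \mu\in\mathscr P_1(\mathsf X).$$ Then $\phi(\mu)=\phi^c(\mu)$ for all $\mu\in\mathscr P_1(\mathsf X)$.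
   Context: A Polish space $(\mathsf X,d)$ is a complete separable metric space. $\bar{\mathbb R}=[-\infty,+\infty]$. $\mathscr P(\mathsf X)$ is the set of Borel probability measures on $\mathsf X$ and $\mathscr P_1(\mathsf X)=\{\mu\in\mathscr P(\mathsf X):\int d(x_0,x)\,\mu(dx)<\infty\}$ for an arbitrary $x_0\in\mathsf X$. The Wasserstein-1 metric on $\mathscr P_1(\mathsf X)$ is $W_1(\mu,\nu)=\inf\{\mathbb E[d(X,Y)]:\mathrm{law}(X)=\mu,\ \mathrm{law}(Y)=\nu\}$. $\mathscr L(\mathsf X)$ is the space of all real-valued Lipschitz functions on $(\mathsf X,d)$ (not necessarily bounded). *)

(* Defs.v *)
From HB Require Import structures.
From mathcomp Require Import all_boot all_order all_algebra.
From mathcomp Require Import all_classical all_reals all_analysis.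
From mathcomp Require Import measurable_realfun giry lra.

Set Implicit Arguments.
Unset Strict Implicit.
Unset Printing Implicit Defensive.

Import Order.TTheory GRing.Theory Num.Def Num.Theory.
Import numFieldTopology.Exports.

Local Open Scope classical_set_scope.
Local Open Scope ring_scope.

(* The structure Complete of the library includes a base point, so these spaces
   are nonempty; on the empty space there is no probability measure at all. *)
#[short(type="completeMetricType")]
HB.structure Definition CompleteMetric (R : numDomainType) :=
  {X of CompletePseudoMetric R X & PseudoMetric_isMetric R X}.

Definition separable (X : topologicalType) : Prop :=
  exists2 D : set X, countable D & dense D.

Notation borel X := (g_sigma_algebraType (@open X)).

Definition lipschitz_functions (R : realType) (X : completeMetricType R) :
    set (X -> R) :=
  [set f | exists K : R, forall x y, `|f x - f y| <= K * mdist x y].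

Definition finite_first_moment (R : realType) (X : completeMetricType R)
    (mu : probability (borel X) R) : Prop :=
  forall x0 : X, (\int[mu]_x (mdist x0 x)%:E < +oo)%E.

(* A term of type probability is a function on all subsets, constrained on the
   measurable ones only: two terms that agree on the Borel sets represent the
   same element of the space of measures. They are then at W1-distance 0 (laws
   are compared with measure_eq below), so that a W1-lower semicontinuous
   function takes the same value at both. *)
Record P1 (R : realType) (X : completeMetricType R) := MkP1 {
  P1_probability :> probability (borel X) R ;
  P1_moment : finite_first_moment P1_probability }.

Lemma measurable_mdist (R : realType) (X : completeMetricType R) (x0 : X) :
  measurable_fun setT (mdist x0 : borel X -> R).
Proof.
have cd : continuous (mdist x0 : X -> R).
  move=> x; apply/cvgrPdist_lt => e e0.
  near=> y.
  have yx : mdist x y < e.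
    by near: y; exact: (metricType_numDomainType.cvgr_dist_lt cvg_id).
  rewrite ltr_norml; have := metric_triangle x0 x y.
  by have := metric_triangle x0 y x; rewrite (metric_sym y x); lra.
apply: (measurability _ (RGenOpens.measurableE R)) => _ [_ [a [b ->] <-]].
rewrite setTI; apply: sub_gen_smallest.
by move/continuousP : cd; apply; exact: interval_open.
Unshelve. all: by end_near. Qed.

Section mixture.
Context (R : realType) (X : completeMetricType R) (t : {i01 R}).

Definition mixture (mu nu : probability (borel X) R) : set (borel X) -> \bar R :=
  measure_add (mscale t%:num%:nng mu) (mscale (1 - t%:num)%:nng nu).

Lemma mixtureE mu nu A :
  mixture mu nu A = (t%:num%:E * mu A + (1 - t%:num)%:E * nu A)%E.
Proof. by rewrite /mixture measure_addE. Qed.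

HB.instance Definition _ mu nu := Measure.on (mixture mu nu).

Let mixture_setT mu nu : mixture mu nu setT = 1%E.
Proof.
by rewrite mixtureE !probability_setT !mule1 -EFinD addrC subrK.
Qed.

HB.instance Definition _ mu nu :=
  Measure_isProbability.Build _ _ _ (mixture mu nu) (mixture_setT mu nu).

Lemma mixture_moment (mu nu : P1 X) :
  finite_first_moment (mixture mu nu : probability (borel X) R).
Proof.
move=> x0.
have d0 x : setT x -> (0 <= (mdist x0 (x : X))%:E :> \bar R)%E.
  by rewrite lee_fin mdist_ge0.
have /measurable_EFinP md := measurable_mdist x0.
rewrite ge0_integral_measure_add//= !ge0_integral_mscale//=.
by rewrite lte_add_pinfty// lte_mul_pinfty// ?P1_moment// lee_fin subr_ge0.
Qed.

Definition P1_mixture (mu nu : P1 X) : P1 X := MkP1 (@mixture_moment mu nu).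

End mixture.

Definition W1 (R : realType) (X : completeMetricType R) (mu nu : P1 X) : \bar R :=
  ereal_inf [set c | exists (d : measure_display) (Omega : measurableType d)
    (P : probability Omega R) (U V : {RV P >-> borel X}),
    [/\ measure_eq (distribution P U) mu,
        measure_eq (distribution P V) nu &
        c = 'E_P[fun w => mdist (U w : X) (V w)]%E ] ].

Definition P1_convex (R : realType) (X : completeMetricType R)
    (phi : P1 X -> \bar R) : Prop :=
  forall (t : {i01 R}) (mu nu : P1 X),
    (phi (P1_mixture t mu nu)
       <= t%:num%:E * phi mu + (1 - t%:num)%:E * phi nu)%E.

Definition W1_lower_semicontinuous (R : realType) (X : completeMetricType R)
    (phi : P1 X -> \bar R) : Prop :=
  forall (mu : P1 X) (a : R), (a%:E < phi mu)%E ->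
    exists2 e : R, 0 < e &
      forall nu : P1 X, (W1 mu nu < e%:E)%E -> (a%:E < phi nu)%E.

Definition proper_convex (R : realType) (X : completeMetricType R)
    (phi : P1 X -> \bar R) : Prop :=
  [/\ P1_convex phi,
      W1_lower_semicontinuous phi,
      forall mu : P1 X, (-oo < phi mu)%E &
      exists mu0 : P1 X, phi mu0 \is a fin_num].

Definition rho (R : realType) (X : completeMetricType R)
    (phi : P1 X -> \bar R) (f : X -> R) : \bar R :=
  ereal_sup [set (\int[mu]_x (f x)%:E - phi mu)%E | mu in [set: P1 X]].

Definition phi_c (R : realType) (X : completeMetricType R)
    (phi : P1 X -> \bar R) (mu : P1 X) : \bar R :=
  ereal_sup [set (\int[mu]_x (f x)%:E - rho phi f)%E
            | f in @lipschitz_functions R X].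

(* Main.v *)
Require Import Defs.
From HB Require Import structures.
From mathcomp Require Import all_boot all_order all_algebra.
From mathcomp Require Import all_classical all_reals all_analysis.
From mathcomp Require Import measurable_realfun ring lra.

Set Implicit Arguments.
Unset Strict Implicit.
Unset Printing Implicit Defensive.

Import Order.TTheory GRing.Theory Num.Def Num.Theory.
Import numFieldTopology.Exports numFieldNormedType.Exports.

Local Open Scope classical_set_scope.
Local Open Scope ring_scope.

(** Why the theorem is true.

    The inequality [phi_c <= phi] is the Fenchel-Young inequality. For the
    converse, fix [mu] and a real number [a < phi mu]. It is enough to find a
    Lipschitz function [f] such that
      [a + \int f d(nu - mu) <= phi nu] for every [nu]        (lemma [affine_minorant]),
    since this says that [rho f <= \int f dmu - a].

    The key point is that the lower semicontinuity of [phi] at [mu] only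
    involves finitely many Lipschitz functions. By [W1_nbhs_lipschitz], every
    Wasserstein ball around [mu] contains the set of all [nu] for which finitely
    many integrals of Lipschitz functions are close to those for [mu]. To see
    this, cover most of [mu] by finitely many small cells, given by a Lipschitz
    partition of unity. If [nu] gives almost the same mass to each cell, most of
    [mu] can be transported to [nu] without leaving the cells. If moreover the
    first moments of the cells and the total first moment are almost the same,
    what remains has a small first moment for both measures, so that any
    coupling of the remainders is cheap. This coupling has an explicit density
    with respect to the product of [mu] and [nu], and its cost is estimated in
    [transport_estimate] and [W1_le_tests].

    What is left is a separation problem in finite dimension. Let [G m nu] be
    the finitely many differences of integrals. If [phi - a] is bounded below by
    [- K * \sum_m |G m|], then the penalty can be replaced by a linear
    combination of the [G m], one term at a time ([lagrange_multipliers]), and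
    this linear combination is the integral of a Lipschitz function. If
    [phi mu] is finite, such a [K] exists because a convex function which is
    bounded below near [mu] decreases at most linearly away from [mu]
    ([affine_minorant_at_finite]). If [phi mu] is infinite, the affine minorant
    obtained at a measure where [phi] is finite controls [phi] far from [mu]. *)

(** * Lagrange multipliers on a convexlike family *)

Section convexlike_separation.
Context (R : realType) (I : Type) (D : set I).

(** Convexity in the sense of Ky Fan: [D] has no linear structure of its own, so
    that a convex combination of [i] and [j] is any point of [D] which looks
    like one to [F] and to the [G m]. *)
Definition convexlike (F : I -> R) n (G : nat -> I -> R) :=
  forall t i j, 0 <= t <= 1 -> D i -> D j -> exists2 k, D k &
    F k <= t * F i + (1 - t) * F j /\
    forall m, (m < n)%N -> G m k = t * G m i + (1 - t) * G m j.

(** The multiplier has to lie above the quotients [- F i / g i] with [g i > 0]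
    and below the quotients [F j / - g j] with [g j < 0]. The former do not
    exceed the latter, because [F] is nonnegative at the point between [i] and [j]
    where [g] vanishes. The penalty [K] bounds the quotients, so that the
    supremum exists even when one of the two families is empty. *)
Lemma lagrange_multiplier1 (F g : I -> R) (K : R) : 0 <= K ->
    convexlike F 1 (fun=> g) ->
    (forall i, D i -> 0 <= F i + K * `|g i|) ->
  exists l, forall i, D i -> 0 <= F i + l * g i.
Proof.
move=> K0 cF FK.
pose S := [set s | s = - K \/ exists i, [/\ D i, 0 < g i & s = - F i / g i]].
have S0 : S !=set0 by exists (- K); left.
have ubS b : - K <= b ->
    (forall i, D i -> 0 < g i -> - F i <= b * g i) -> ubound S b.
  by move=> Kb h _ [->//|[i [Di gi ->]]]; rewrite ler_pdivrMr// h.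
have KS : ubound S K.
  apply: ubS => [|i Di gi]; first lra.
  by have := FK _ Di; rewrite gtr0_norm//; lra.
have hS : has_sup S by split=> //; exists K.
exists (sup S) => i Di; have [gi|gi|gi] := ltgtP (g i) 0; last first.
- by have := FK _ Di; rewrite gi normr0 !mulr0.
- have : - F i / g i <= sup S by apply: ub_le_sup; [exists K|right; exists i].
  by rewrite ler_pdivrMr//; lra.
- have : sup S <= F i / - g i.
    apply: ge_sup => //; apply: ubS.
      by rewrite ler_pdivlMr ?oppr_gt0//; have := FK _ Di; rewrite ltr0_norm//; lra.
    move=> j Dj gj.
    (* [t] is the weight of [j] for which [g] vanishes between [j] and [i] *)
    have h0 : 0 < g j - g i by lra.
    pose t := - g i / (g j - g i).
    have tE : t * (g j - g i) = - g i by rewrite /t mulfVK// gt_eqF.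
    have t01 : 0 <= t <= 1.
      by rewrite /t divr_ge0 ?ler_pdivrMr ?mul1r//; lra.
    have [k Dk [Fk /(_ 0%N isT) gk]] := cF _ _ _ t01 Dj Di.
    have gk0 : g k = 0 by rewrite gk; lra.
    have := FK _ Dk; rewrite gk0 normr0 mulr0 addr0 => Fk0.
    have F0 : 0 <= t * F j + (1 - t) * F i by exact: le_trans Fk.
    have : 0 <= (t * F j + (1 - t) * F i) * (g j - g i).
      by rewrite mulr_ge0// ltW.
    have -> : (t * F j + (1 - t) * F i) * (g j - g i) =
      t * (g j - g i) * F j + ((g j - g i) - t * (g j - g i)) * F i by ring.
    rewrite tE => h.
    by rewrite mulrAC ler_pdivlMr ?oppr_gt0//; lra.
  by rewrite ler_pdivlMr ?oppr_gt0//; lra.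
Qed.

(** The penalties are turned into linear terms one at a time. Those which are
    still to be treated are absolute values of affine functions, hence can be
    counted as part of the convex function. *)
Lemma lagrange_multipliers (F : I -> R) n (G : nat -> I -> R) (K : R) : 0 <= K ->
    convexlike F n G ->
    (forall i, D i -> 0 <= F i + K * \sum_(m < n) `|G m i|) ->
  exists l : nat -> R, forall i, D i -> 0 <= F i + \sum_(m < n) l m * G m i.
Proof.
move=> K0; elim: n F => [|n IH] F cF FK.
  by exists (fun=> 0) => i /FK; rewrite !big_ord0 mulr0.
have [|i|l hl] := @lagrange_multiplier1
    (fun i => F i + K * \sum_(m < n) `|G m i|) (G n) K K0.
- move=> t i j /andP[t0 t1] Di Dj.
  have [|k Dk [Fk Gk]] := cF t i j _ Di Dj; first by rewrite t0.
  exists k => //; split=> [|_ _]; last exact: Gk.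
  suff : \sum_(m < n) `|G m k| <=
      t * (\sum_(m < n) `|G m i|) + (1 - t) * (\sum_(m < n) `|G m j|).
    move=> /(ler_wpM2l K0); lra.
  rewrite !mulr_sumr -big_split/=; apply: ler_sum => m _.
  rewrite Gk 1?ltnS 1?ltnW//; apply: (le_trans (ler_normD _ _)).
  by rewrite !normrM (ger0_norm t0) (@ger0_norm _ (1 - t)) ?lexx ?subr_ge0.
- by move=> /FK; rewrite big_ord_recr/= mulrDr addrA.
have [|i Di|l' hl'] := IH (fun i => F i + l * G n i).
- move=> t i j t01 Di Dj.
  have [k Dk [Fk Gk]] := cF t i j t01 Di Dj.
  exists k => //; split=> [|m mn]; last by rewrite Gk// ltnS ltnW.
  by rewrite Gk//; lra.
- by rewrite addrAC hl.
exists (fun m => if m == n then l else l' m) => i Di.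
rewrite big_ord_recr/= eqxx [X in F i + X]addrC addrA.
rewrite (eq_bigr (fun m : 'I_n => l' m * G m i)) ?hl'//.
by move=> m _; rewrite ltn_eqF.
Qed.

End convexlike_separation.

(** * Integrals of Lipschitz functions *)

Section lipschitz.
Context (R : realType) (X : completeMetricType R).
Implicit Types f g : X -> R.
Local Notation lip := (@lipschitz_functions R X).

Lemma lipschitz_cst c : lip (fun=> c).
Proof. by exists 0 => x y; rewrite subrr normr0 mul0r. Qed.

Lemma lipschitz_mdist x0 : lip (mdist x0).
Proof.
exists 1 => x y; rewrite mul1r ler_norml.
have := metric_triangle x0 x y; have := metric_triangle x0 y x.
by rewrite (metric_sym y x); lra.
Qed.

Lemma lipschitzZ k f : lip f -> lip (fun x => k * f x).
Proof.
move=> [K Kf]; exists (`|k| * K) => x y.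
by rewrite -mulrBr normrM -mulrA ler_wpM2l.
Qed.

Lemma lipschitzD f g : lip f -> lip g -> lip (fun x => f x + g x).
Proof.
move=> [K Kf] [L Lg]; exists (K + L) => x y.
by rewrite opprD addrACA mulrDl (le_trans (ler_normD _ _))// lerD.
Qed.

Lemma lipschitz_max f g : lip f -> lip g -> lip (fun x => Num.max (f x) (g x)).
Proof.
move=> [K Kf] [L Lg]; exists (`|K| + `|L|) => x y.
have d0 := mdist_ge0 x y.
have Kd : K * mdist x y <= `|K| * mdist x y by rewrite ler_wpM2r ?ler_norm.
have Ld : L * mdist x y <= `|L| * mdist x y by rewrite ler_wpM2r ?ler_norm.
have Kd0 : 0 <= `|K| * mdist x y by rewrite mulr_ge0.
have Ld0 : 0 <= `|L| * mdist x y by rewrite mulr_ge0.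
have := Kf x y; have := Lg x y; rewrite !ler_norml mulrDl => /andP[? ?] /andP[? ?].
by case: (leP (f x) (g x)); case: (leP (f y) (g y)); lra.
Qed.

(** In [g x * (f x - f y) + f y * (g x - g y)], the unbounded function [g] only
    appears at a point where [f] is nonzero, once [x] and [y] are put in the
    right order. *)
Lemma lipschitzM f g D : lip f -> lip g -> (forall x, `|f x| <= 1) ->
  (forall x, f x != 0 -> `|g x| <= D) -> lip (fun x => f x * g x).
Proof.
move=> [K Kf] [L Lg] f1 gD; exists (`|D| * `|K| + `|L|) => x y.
wlog fx : x y / f x != 0.
  move=> H; have [fx0|/H//] := eqVneq (f x) 0.
  have [fy0|/(H y x)] := eqVneq (f y) 0.
    rewrite fx0 fy0 !mul0r subrr normr0.
    by rewrite mulr_ge0 ?mdist_ge0// addr_ge0// mulr_ge0.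
  by rewrite distrC metric_sym.
have d0 := mdist_ge0 x y.
have -> : f x * g x - f y * g y = g x * (f x - f y) + f y * (g x - g y) by ring.
rewrite mulrDl (le_trans (ler_normD _ _))// !normrM lerD//.
  rewrite -mulrA ler_pM//; first by rewrite (le_trans (gD _ fx))// ler_norm.
  by rewrite (le_trans (Kf _ _))// ler_wpM2r ?ler_norm.
rewrite (le_trans (ler_piMl _ (f1 y)))// (le_trans (Lg _ _))//.
by rewrite ler_wpM2r ?ler_norm.
Qed.

Lemma lipschitz_lincomb n (k : nat -> R) (f : nat -> X -> R) :
  (forall m, lip (f m)) -> lip (fun x => \sum_(m < n) k m * f m x).
Proof.
move=> lf; elim: n => [|n IH].
  by under eq_fun do rewrite big_ord0; exact: lipschitz_cst.
under eq_fun do rewrite big_ord_recr.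
by apply: lipschitzD => //; exact: lipschitzZ.
Qed.

Lemma lipschitz_continuous f : lip f -> continuous f.
Proof.
move=> [K Kf] x; apply/cvgrPdist_lt => e e0.
have K0 : 0 < `|K| + 1 by rewrite ltr_wpDl.
near=> y.
have xy : mdist x y < e / (`|K| + 1).
  near: y; apply: (metricType_numDomainType.cvgr_dist_lt cvg_id).
  by rewrite divr_gt0.
apply: (le_lt_trans (Kf x y)); apply: (@le_lt_trans _ _ ((`|K| + 1) * mdist x y)).
  by rewrite ler_wpM2r ?mdist_ge0// (le_trans (ler_norm _))// lerDl.
by rewrite mulrC -ltr_pdivlMr.
Unshelve. all: by end_near. Qed.

Lemma continuous_measurable_borel (f : X -> R) :
  continuous f -> measurable_fun setT (f : borel X -> R).
Proof.
move=> cf; apply: (measurability _ (RGenOpens.measurableE R)).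
move=> _ [_ [a [b ->] <-]]; rewrite setTI; apply: sub_gen_smallest.
by move/continuousP : cf; apply; exact: interval_open.
Qed.

Lemma lipschitz_measurable f : lip f -> measurable_fun setT (f : borel X -> R).
Proof. by move/lipschitz_continuous; exact: continuous_measurable_borel. Qed.

(** A Lipschitz function grows at most like the distance to a base point. *)
Lemma lipschitz_integrable (mu : P1 X) f : lip f ->
  mu.-integrable setT (EFin \o (f : borel X -> R)).
Proof.
move=> lf; have mf := lipschitz_measurable lf; case: lf => K Kf.
pose x0 : X := point.
apply: (@le_integrable _ (borel X) _ mu _ _ _
  (fun x => (`|f x0| + `|K| * mdist x0 (x : X))%:E)) => //.
- exact/measurable_EFinP.
- move=> x _ /=; rewrite lee_fin [leRHS]ger0_norm; last first.
    by rewrite addr_ge0// mulr_ge0 ?mdist_ge0.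
  rewrite -[f x](subrK (f x0)) addrC (le_trans (ler_normD _ _))// lerD2l.
  rewrite distrC (le_trans (Kf _ _))// ler_wpM2r ?mdist_ge0//.
  exact: ler_norm.
- under eq_fun do rewrite EFinD EFinM.
  apply: integrableD => //; first exact: finite_measure_integrable_cst.
  apply: integrableZl => //; apply/integrableP; split.
    by apply/measurable_EFinP; exact: measurable_mdist.
  under eq_integral => x _ do rewrite gee0_abs ?lee_fin ?mdist_ge0//.
  exact: P1_moment.
Qed.

Lemma EFin_Rintegral_lip (mu : P1 X) f : lip f ->
  (\int[mu]_x (f x)%:E)%E = (\int[mu]_x f x)%:E.
Proof.
move=> lf; rewrite /Rintegral fineK//.
exact: integrable_fin_num (lipschitz_integrable mu lf).
Qed.

Lemma lip_RintegralD (mu : P1 X) f g : lip f -> lip g ->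
  \int[mu]_x (f x + g x) = \int[mu]_x f x + \int[mu]_x g x.
Proof. by move=> lf lg; rewrite RintegralD//; exact: lipschitz_integrable. Qed.

Lemma lip_RintegralZ (mu : P1 X) k f : lip f ->
  \int[mu]_x (k * f x) = k * \int[mu]_x f x.
Proof. by move=> lf; rewrite RintegralZl//; exact: lipschitz_integrable. Qed.

Lemma lip_Rintegral_cst (mu : P1 X) c : \int[mu]_x c = c.
Proof.
rewrite Rintegral_cst// [X in fine X](_ : _ = 1%E) ?mulr1//.
exact: probability_setT.
Qed.

Lemma lip_Rintegral_sum (mu : P1 X) n (k : nat -> R) (f : nat -> X -> R) :
    (forall m, lip (f m)) ->
  \int[mu]_x (\sum_(m < n) k m * f m x) = \sum_(m < n) k m * \int[mu]_x f m x.
Proof.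
move=> lf; elim: n => [|n IH].
  by under eq_Rintegral do rewrite big_ord0; rewrite lip_Rintegral_cst big_ord0.
under eq_Rintegral do rewrite big_ord_recr/=.
rewrite big_ord_recr/= -IH -lip_RintegralZ// lip_RintegralD//; last exact: lipschitzZ.
exact: lipschitz_lincomb.
Qed.

Lemma le_lip_Rintegral (mu : P1 X) f g : lip f -> lip g ->
  (forall x, f x <= g x) -> \int[mu]_x f x <= \int[mu]_x g x.
Proof. by move=> lf lg fg; apply: le_Rintegral => //; exact: lipschitz_integrable. Qed.

Lemma lipschitz_comb n k0 f (k : nat -> R) (g : nat -> X -> R) :
    lip f -> (forall m, lip (g m)) ->
  lip (fun x => k0 * f x + \sum_(m < n) k m * g m x).
Proof.
move=> lf lg; apply: lipschitzD; first exact: lipschitzZ.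
exact: lipschitz_lincomb.
Qed.

Lemma lip_Rintegral_comb (mu : P1 X) n k0 f (k : nat -> R) (g : nat -> X -> R) :
    lip f -> (forall m, lip (g m)) ->
  \int[mu]_x (k0 * f x + \sum_(m < n) k m * g m x) =
  k0 * \int[mu]_x f x + \sum_(m < n) k m * \int[mu]_x g m x.
Proof.
move=> lf lg; rewrite lip_RintegralD ?lip_RintegralZ ?lip_Rintegral_sum//.
  exact: lipschitzZ.
exact: lipschitz_lincomb.
Qed.

Lemma Rintegral_mixture (t : {i01 R}) (mu nu : P1 X) f : lip f ->
  \int[P1_mixture t mu nu]_x f x =
  t%:num * (\int[mu]_x f x) + (1 - t%:num) * (\int[nu]_x f x).
Proof.
move=> lf.
have mix (g : borel X -> \bar R) : measurable_fun setT g -> (forall x, 0 <= g x)%E ->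
  (\int[P1_mixture t mu nu]_x g x = t%:num%:E * \int[mu]_x g x +
    (1 - t%:num)%:E * \int[nu]_x g x)%E.
  move=> mg g0; rewrite /P1_mixture/= /mixture ge0_integral_measure_add//=.
  rewrite !ge0_integral_mscale//.
have mf : measurable_fun setT (EFin \o (f : borel X -> R)).
  by apply/measurable_EFinP; exact: lipschitz_measurable lf.
have fi (m : P1 X) := lipschitz_integrable m lf.
have posE (m : P1 X) :
    (\int[m]_x ((EFin \o (f : borel X -> R))^\+ x) \is a fin_num)%E.
  exact: (integrable_pos_fin_num _ (fi m)).
have negE (m : P1 X) :
    (\int[m]_x ((EFin \o (f : borel X -> R))^\- x) \is a fin_num)%E.
  exact: (integrable_neg_fin_num _ (fi m)).
have E (m : P1 X) : \int[m]_x f x =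
   fine (\int[m]_x ((EFin \o (f : borel X -> R))^\+ x))%E -
   fine (\int[m]_x ((EFin \o (f : borel X -> R))^\- x))%E.
  by rewrite -fineB//; congr fine; rewrite -integralE.
rewrite !E mix//; last exact: measurable_funepos.
rewrite mix//; last exact: measurable_funeneg.
move: (posE mu) (posE nu) (negE mu) (negE nu).
case: (integral mu) => [a||]//; case: (integral nu) => [b||]//.
case: (integral mu) => [c||]//; case: (integral nu) => [d||]// _ _ _ _ /=; lra.
Qed.

End lipschitz.

(** * Probability measures given by a density *)

Section density.
Context d (T : measurableType d) (R : realType).
Variable m : probability T R.

(** The hypotheses on [w] are arguments, so that the probability structure
    attached to [density] below can be inferred from the term alone. *)
Definition density (w : T -> R) of (forall x, 0 <= w x) & measurable_fun setT w
    & (\int[m]_x (w x)%:E = 1)%E :=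
  fun A : set T => (\int[m]_(x in A) (w x)%:E)%E.

Variable w : T -> R.
Hypotheses (w0 : forall x, 0 <= w x) (mw : measurable_fun setT w).
Hypothesis w1 : (\int[m]_x (w x)%:E = 1)%E.

Local Notation P := (density w0 mw w1).

Let P0 : P set0 = 0%E.
Proof. exact: integral_set0. Qed.

Let P_ge0 A : (0 <= P A)%E.
Proof. by apply: integral_ge0 => x _; rewrite lee_fin. Qed.

Let P_sigma_additive : semi_sigma_additive P.
Proof.
move=> /= F mF tF mUF; rewrite /density; apply: cvg_toP.
  apply: ereal_nondecreasing_is_cvgn => k l kl.
  by apply: lee_sum_nneg_natr => // i _ _; apply: integral_ge0 => x _; rewrite lee_fin.
rewrite ge0_integral_bigcup//=.
- exact/measurable_EFinP/measurable_funTS.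
- by move=> x _; rewrite lee_fin.
Qed.

HB.instance Definition _ := isMeasure.Build _ _ _ P P0 P_ge0 P_sigma_additive.

HB.instance Definition _ := @Measure_isProbability.Build _ _ _ P w1.

Definition density_probability : probability T R := P.

Lemma density_dominated : P `<< m.
Proof.
apply/null_content_dominatesP => A mA mA0; rewrite /density.
apply: null_set_integral => //; exact/measurable_EFinP/measurable_funTS.
Qed.

(** The density [w] is a version of the Radon-Nikodym derivative, for which the
    change of variables is known. *)
Lemma ge0_integral_density (f : T -> \bar R) : measurable_fun setT f ->
  (forall x, 0 <= f x)%E -> (\int[P]_x f x = \int[m]_x (f x * (w x)%:E))%E.
Proof.
move=> mf f0; have Pm := density_dominated.
rewrite -(Radon_Nikodym_SigmaFinite.change_of_variables Pm)//.
have mw' : measurable_fun setT (EFin \o w) by exact/measurable_EFinP.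
have ifP := Radon_Nikodym_SigmaFinite.f_integrable Pm.
have mfP := measurable_int _ ifP.
apply: ae_eq_integral => //; try exact: emeasurable_funM.
have : ae_eq m setT (Radon_Nikodym_SigmaFinite.f P m) (EFin \o w).
  apply: integral_ae_eq => // E _ mE.
  by rewrite -Radon_Nikodym_SigmaFinite.f_integral.
by apply: filterS => x /(_ I) ->.
Qed.

End density.

(** * Couplings with a density *)

Section coupling.
Context (R : realType) (X : completeMetricType R) (s : nat -> X).
Hypothesis dense_s : forall x (e : R), 0 < e -> exists n, mdist x (s n) < e.
Local Notation XX := (borel X * borel X)%type.

(** Separability makes the distance measurable for the product of the Borel
    sigma-algebras: it is less than [r] at [(x, y)] if and only if some [s n]
    satisfies [mdist (s n) x + mdist (s n) y < r], and both summands are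
    functions of one variable. *)
Lemma measurable_mdist2 :
  measurable_fun setT (fun z : XX => mdist (z.1 : X) (z.2 : X)).
Proof.
apply: (measurability _ (RGenInftyO.measurableE R)) => _ [_ [r ->] <-].
pose f n (z : XX) := mdist (s n) (z.1 : X) + mdist (s n) (z.2 : X).
have mf n : measurable_fun setT (f n).
  apply: measurable_funD; apply: measurableT_comp => //; exact: measurable_mdist.
rewrite setTI (_ : _ @^-1` _ = \bigcup_n (f n @^-1` `]-oo, r[)).
  apply: bigcup_measurable => n _; rewrite -[X in measurable X]setTI; exact: mf.
apply/seteqP; split => [z|z [n _]]; rewrite /= !in_itv/=.
  move=> zr; have [|n nz] := @dense_s z.1 ((r - mdist z.1 z.2) / 2).
    by rewrite divr_gt0 ?subr_gt0.
  exists n => //; rewrite /= in_itv/= /f.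
  move: nz; have := metric_triangle (s n) z.1 z.2; rewrite (metric_sym z.1 (s n)); lra.
apply: le_lt_trans; rewrite /f (metric_sym (s n) z.1).
exact: metric_triangle.
Qed.

(** By Tonelli's theorem, the hypotheses on [w] say that the probability measure
    with density [w] has the marginals [mu] and [nu]. *)
Lemma W1_le_density (mu nu : P1 X) (w : XX -> R) :
    (forall z, 0 <= w z) -> measurable_fun setT w ->
    (forall x, \int[nu]_y (w (x, y))%:E = 1)%E ->
    (forall y, \int[mu]_x (w (x, y))%:E = 1)%E ->
  (W1 mu nu <= \int[(mu \x nu)%E]_z (mdist (z.1 : X) (z.2 : X) * w z)%:E)%E.
Proof.
move=> w0 mw wnu wmu.
have mw' : measurable_fun setT (EFin \o w) by exact/measurable_EFinP.
have w0' z : (0 <= (EFin \o w) z)%E by rewrite lee_fin.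
have w1 : (\int[(mu \x nu)%E]_z (w z)%:E = 1)%E.
  rewrite (fubini_tonelli1 (EFin \o w))// /fubini_F/=.
  under eq_integral do rewrite wnu.
  by rewrite integral_cst// mul1e; exact: (@probability_setT _ _ _ (P1_probability mu)).
pose m : probability XX R := (mu \x nu)%E.
pose P : probability XX R := @density_probability _ _ _ m w w0 mw w1.
pose U : {RV P >-> borel X} := mfun_Sub (mem_set measurable_fst).
pose V : {RV P >-> borel X} := mfun_Sub (mem_set measurable_snd).
have md := measurable_mdist2.
apply: ereal_inf_lbound; exists _, XX, P, U, V; split.
- move=> A mA; rewrite /distribution /pushforward/= /P/= /density.
  have mA' : measurable ((fst : XX -> borel X) @^-1` A).
    by rewrite -[X in measurable X]setTI; exact: measurable_fst.
  rewrite integral_mkcond fubini_tonelli1//; last 2 first.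
  + by apply/measurable_restrict => //; rewrite setTI; exact: measurable_funTS.
  + by move=> z; apply: erestrict_ge0 => t _; rewrite lee_fin.
  rewrite -[in RHS](setIT A) -integral_indic//; apply: eq_integral => x _.
  rewrite /fubini_F indicE; have [xA|xA] := boolP (x \in A).
    rewrite -[RHS](wnu x); apply: eq_integral => y _.
    by rewrite patchT// inE; rewrite inE in xA.
  by apply: integral0_eq => y _; rewrite patchN//; apply: contra xA; rewrite !inE.
- move=> A mA; rewrite /distribution /pushforward/= /P/= /density.
  have mA' : measurable ((snd : XX -> borel X) @^-1` A).
    by rewrite -[X in measurable X]setTI; exact: measurable_snd.
  rewrite integral_mkcond fubini_tonelli2//; last 2 first.
  + by apply/measurable_restrict => //; rewrite setTI; exact: measurable_funTS.
  + by move=> z; apply: erestrict_ge0 => t _; rewrite lee_fin.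
  rewrite -[in RHS](setIT A) -integral_indic//; apply: eq_integral => y _.
  rewrite /fubini_G indicE; have [yA|yA] := boolP (y \in A).
    rewrite -[RHS](wmu y); apply: eq_integral => x _.
    by rewrite patchT// inE; rewrite inE in yA.
  by apply: integral0_eq => x _; rewrite patchN//; apply: contra yA; rewrite !inE.
- rewrite unlock /= ge0_integral_density//=.
  + exact/measurable_EFinP.
  + by move=> x; rewrite lee_fin mdist_ge0.
Qed.

End coupling.

(** * The cost of a transport that keeps most of the mass in small cells *)

(** In a cell of masses [p] and [q], the fraction [(1 - eta) / max p q * q] of the
    first measure will be kept in the cell. It differs from [1 - eta] by at most
    [d / max p q], and the denominator is absorbed by [I <= D * p], where [I] is
    the first moment of the cell. For an empty cell, [I] vanishes. *)
Lemma kept_mass_defect (R : realFieldType) (p q I D d eta : R) :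
  0 <= p -> 0 <= q -> 0 <= I -> I <= D * p -> `|q - p| <= d -> 0 <= D ->
  0 < eta < 1 ->
  (1 - eta) * I - (1 - eta) / Num.max p q * q * I <= D * d.
Proof.
move=> p0 q0 I0 ID qp D0 /andP[eta0 eta1].
have d0 : 0 <= d by apply: le_trans qp.
have [M0|M0] := eqVneq (Num.max p q) 0.
  have Ile0 : I <= 0.
    rewrite (le_trans ID)// (_ : p = 0) ?mulr0//; apply/le_anti.
    by rewrite p0 -M0 le_max lexx.
  have -> : I = 0 by apply/le_anti; rewrite Ile0.
  by rewrite !mulr0 subrr mulr_ge0.
have Mp : 0 < Num.max p q by rewrite lt_neqAle eq_sym M0 le_max p0.
have -> : (1 - eta) * I - (1 - eta) / Num.max p q * q * I =
    (1 - eta) * ((Num.max p q - q) * (I / Num.max p q)) by field.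
rewrite -[leRHS]mul1r ler_pM//; first by lra.
- rewrite mulr_ge0 ?divr_ge0//; last exact: ltW.
  by rewrite subr_ge0 le_max lexx orbT.
- by lra.
rewrite mulrC ler_pM ?divr_ge0//; first exact: ltW.
- by rewrite subr_ge0 le_max lexx orbT.
- by rewrite ler_pdivrMr// (le_trans ID)// ler_wpM2l// le_max lexx.
- rewrite maxEle; case: ifP => _; first by rewrite subrr.
  by rewrite (le_trans (ler_norm _))// distrC.
Qed.

Section transport_estimate.
Context (R : realType) (X : completeMetricType R) (s : nat -> X).
Hypothesis dense_s : forall x (e : R), 0 < e -> exists n, mdist x (s n) < e.
Local Notation lip := (@lipschitz_functions R X).
Local Notation XX := (borel X * borel X)%type.
(* The cells are the functions [h i]: the cell [h i] is supported in the ball of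
   radius [r] around [c i], and at distance at most [D i] from [x0]. *)
Variables (x0 : X) (n : nat) (h : nat -> X -> R) (c : nat -> X)
  (r : R) (D : nat -> R).
Hypotheses (lh : forall i, lip (h i)) (r_ge0 : 0 <= r)
  (h_ge0 : forall i x, 0 <= h i x)
  (h_le1 : forall i x, h i x <= 1) (sum_h : forall x, \sum_(i < n) h i x <= 1)
  (h_r : forall i x, h i x * mdist (c i) x <= r * h i x)
  (h_D : forall i x, h i x != 0 -> mdist x0 x <= D i).

Definition dist_part i x := h i x * mdist x0 x.

Lemma lip_dist_part i : lip (dist_part i).
Proof.
apply: (@lipschitzM _ _ _ _ (D i)) => //; first exact: lipschitz_mdist.
- by move=> x; rewrite ger0_norm.
- by move=> x hx; rewrite ger0_norm ?mdist_ge0// h_D.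
Qed.

(** If the fraction [k i] of each cell is removed from a measure, what remains
    has the density [leftover k] with respect to this measure. The shape [1 * 1 + _] is that of a linear
    combination to which [lip_Rintegral_comb] applies. *)
Definition leftover (k : nat -> R) x := 1 * 1 + \sum_(i < n) - k i * h i x.

(** This is the product of the distance to [x0] and [leftover k], expanded so
    that every term is Lipschitz. *)
Definition leftover_dist (k : nat -> R) x :=
  1 * mdist x0 x + \sum_(i < n) - k i * dist_part i x.

Lemma leftover_distE k x : leftover_dist k x = mdist x0 x * leftover k x.
Proof.
rewrite /leftover_dist /leftover !mul1r mulrDr mulr1 mulr_sumr; congr +%R.
by apply: eq_bigr => i _; rewrite /dist_part; ring.
Qed.

Lemma lip_leftover k : lip (leftover k).
Proof. exact: (@lipschitz_comb _ _ n 1 _ (fun i => - k i) _ (lipschitz_cst X 1) lh). Qed.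

Lemma lip_leftover_dist k : lip (leftover_dist k).
Proof.
exact: (@lipschitz_comb _ _ n 1 _ (fun i => - k i) _ (lipschitz_mdist x0) lip_dist_part).
Qed.

Lemma leftover_ge0 k x : (forall i, k i <= 1) -> 0 <= leftover k x.
Proof.
move=> k1; rewrite /leftover mul1r.
suff : \sum_(i < n) h i x + \sum_(i < n) - k i * h i x >= 0.
  have := sum_h x; lra.
rewrite -big_split sumr_ge0//= => i _.
by rewrite mulNr -{1}[h i x]mul1r -mulrBl mulr_ge0 ?subr_ge0.
Qed.

Variables (mu nu : P1 X) (eta : R).
Hypothesis eta01 : 0 < eta < 1.
Let p i := \int[mu]_x h i x.
Let q i := \int[nu]_x h i x.
(* [w i * p i * q i] is [(1 - eta) * min (p i) (q i)], the mass which is kept in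
   the cell; for an empty cell, [0^-1 = 0] gives [w i = 0] *)
Let w i := (1 - eta) / Num.max (p i) (q i).
Let u i := w i * q i.
Let v i := w i * p i.

Let p0 i : 0 <= p i. Proof. exact: Rintegral_ge0. Qed.
Let q0 i : 0 <= q i. Proof. exact: Rintegral_ge0. Qed.
Let w0 i : 0 <= w i.
Proof.
by rewrite divr_ge0// ?subr_ge0 ?le_max ?p0//; case/andP: eta01 => _ /ltW.
Qed.

Let wq i x : x <= Num.max (p i) (q i) -> w i * x <= 1 - eta.
Proof.
move=> xM; have /andP[_ /ltW e1] := eta01.
have [M0|M0] := eqVneq (Num.max (p i) (q i)) 0.
  by rewrite /w M0 invr0 mulr0 mul0r subr_ge0.
rewrite /w -mulrA ler_piMr ?subr_ge0// mulrC ler_pdivrMr ?mul1r//.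
by rewrite lt_neqAle eq_sym M0 le_max p0.
Qed.

Let u_le i : u i <= 1 - eta. Proof. by rewrite wq// le_max lexx orbT. Qed.
Let v_le i : v i <= 1 - eta. Proof. by rewrite wq// le_max lexx. Qed.
Let u_le1 i : u i <= 1.
Proof. by apply: (le_trans (u_le i)); have /andP[? _] := eta01; lra. Qed.
Let v_le1 i : v i <= 1.
Proof. by apply: (le_trans (v_le i)); have /andP[? _] := eta01; lra. Qed.

Let kept := \sum_(i < n) w i * p i * q i.
Let m := 1 - kept.

Let sum_q : \sum_(i < n) q i <= 1.
Proof.
have := lip_Rintegral_sum nu n (fun=> 1) lh.
under [in X in _ = X]eq_bigr do rewrite mul1r.
rewrite -/q => <-; rewrite -[leRHS](lip_Rintegral_cst nu).
apply: le_lip_Rintegral; [|exact: lipschitz_cst|].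
  exact: (@lipschitz_lincomb _ _ n (fun=> 1) _ lh).
by move=> x; under eq_bigr do rewrite mul1r.
Qed.

Let m_gt0 : 0 < m.
Proof.
suff : kept <= 1 - eta by rewrite /m; have /andP[? _] := eta01; lra.
have e1 : 0 <= 1 - eta by have /andP[_ ?] := eta01; lra.
apply: (@le_trans _ _ (\sum_(i < n) (1 - eta) * q i)).
  by apply: ler_sum => i _; rewrite ler_wpM2r// v_le.
by rewrite -mulr_sumr ler_piMr.
Qed.

Let int_leftover_u : \int[mu]_x leftover u x = m.
Proof.
rewrite [LHS](lip_Rintegral_comb mu n 1 (fun i => - u i) (lipschitz_cst X 1) lh).
rewrite lip_Rintegral_cst mul1r /m /kept -sumrN; congr +%R.
by apply: eq_bigr => i _; rewrite /u -/(p i); ring.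
Qed.

Let int_leftover_v : \int[nu]_x leftover v x = m.
Proof.
rewrite [LHS](lip_Rintegral_comb nu n 1 (fun i => - v i) (lipschitz_cst X 1) lh).
rewrite lip_Rintegral_cst mul1r /m /kept -sumrN; congr +%R.
by apply: eq_bigr => i _; rewrite /v -/(q i); ring.
Qed.

(* The coupling: the mass kept in a cell is distributed as the normalised
   product of the two measures restricted to the cell, and the leftovers, both
   of mass [m], are coupled independently. The factor [1 - eta] in the weights
   ensures that [m] is positive. *)
Let dens (z : XX) := leftover u z.1 / m * leftover v z.2 +
  \sum_(i < n) w i * h i z.1 * h i z.2.

Let dens_ge0 z : 0 <= dens z.
Proof.
rewrite addr_ge0//.
  by apply: mulr_ge0; [apply: divr_ge0; [|exact: ltW]|]; exact: leftover_ge0.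
by apply: sumr_ge0 => i _; apply: mulr_ge0 => //; apply: mulr_ge0.
Qed.

Let measurable_fst_lip f : lip f -> measurable_fun setT (fun z : XX => f z.1).
Proof.
move=> lf; apply: (@measurableT_comp _ _ _ _ _ _ (f : borel X -> R) _ fst) => //.
exact: lipschitz_measurable.
Qed.

Let measurable_snd_lip f : lip f -> measurable_fun setT (fun z : XX => f z.2).
Proof.
move=> lf; apply: (@measurableT_comp _ _ _ _ _ _ (f : borel X -> R) _ snd) => //.
exact: lipschitz_measurable.
Qed.

Let measurable_dens : measurable_fun setT dens.
Proof.
apply: measurable_funD.
  apply: measurable_funM; last exact: (measurable_snd_lip (lip_leftover v)).
  by apply: measurable_funM => //; exact: (measurable_fst_lip (lip_leftover u)).
apply: measurable_sum => i; apply: measurable_funM; last exact: measurable_snd_lip.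
by apply: measurable_funM => //; exact: measurable_fst_lip.
Qed.

Let lip_dens x : lip (fun y => dens (x, y)).
Proof.
rewrite /dens/=.
exact: (@lipschitz_comb _ _ n _ _ (fun i => w i * h i x) _ (lip_leftover v) lh).
Qed.

Let dens_nu x : (\int[nu]_y (dens (x, y))%:E = 1)%E.
Proof.
rewrite (EFin_Rintegral_lip nu (lip_dens x)) /dens/=; congr EFin.
rewrite [LHS](lip_Rintegral_comb nu n _ (fun i => w i * h i x) (lip_leftover v) lh).
rewrite int_leftover_v.
rewrite divfK ?gt_eqF// /leftover mul1r -addrA -big_split big1 ?addr0//= => i _.
by rewrite /u -/(q i); ring.
Qed.

Let dens_mu y : (\int[mu]_x (dens (x, y))%:E = 1)%E.
Proof.
have E x : dens (x, y) = leftover v y / m * leftover u x +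
    \sum_(i < n) w i * h i y * h i x.
  rewrite /dens/=; congr +%R; first by ring.
  by apply: eq_bigr => i _; ring.
under eq_integral do rewrite E.
rewrite EFin_Rintegral_lip; last first.
  exact: (@lipschitz_comb _ _ n _ _ (fun i => w i * h i y) _ (lip_leftover u) lh).
congr EFin.
rewrite [LHS](lip_Rintegral_comb mu n _ (fun i => w i * h i y) (lip_leftover u) lh).
rewrite int_leftover_u.
rewrite divfK ?gt_eqF// /leftover mul1r -addrA -big_split big1 ?addr0//= => i _.
by rewrite /v -/(p i); ring.
Qed.

Let Sv := \int[nu]_y leftover_dist v y.

(* Two points of a cell are at distance at most [2 * r], through the centre of
   the cell, and the leftovers are transported through [x0]. *)
Let inner_cost x : (\int[nu]_y (mdist x y * dens (x, y))%:E <=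
  (leftover_dist u x + Sv / m * leftover u x +
    \sum_(i < n) 2 * r * u i * h i x)%:E)%E.
Proof.
pose B y := leftover_dist u x / m * leftover v y + (leftover u x / m * leftover_dist v y +
    \sum_(i < n) 2 * r * w i * h i x * h i y).
have lB1 : lip (fun y => leftover u x / m * leftover_dist v y +
    \sum_(i < n) 2 * r * w i * h i x * h i y).
  exact: (@lipschitz_comb _ _ n _ _ (fun i => 2 * r * w i * h i x) _
    (lip_leftover_dist v) lh).
have lB : lip B.
  by apply: lipschitzD => //; apply: lipschitzZ; exact: lip_leftover.
apply: (@le_trans _ _ (\int[nu]_y (B y)%:E)%E).
  apply: ge0_le_integral => //.
  - by move=> y _; rewrite lee_fin mulr_ge0 ?mdist_ge0.
  - apply/measurable_EFinP/measurable_funM; first exact: measurable_mdist.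
    exact: lipschitz_measurable.
  - by apply/measurable_EFinP; exact: lipschitz_measurable.
  - move=> y _; rewrite lee_fin /dens mulrDr /= /B !leftover_distE addrA lerD//.
      rewrite -subr_ge0.
      have -> : mdist x0 x * leftover u x / m * leftover v y +
        leftover u x / m * (mdist x0 y * leftover v y) -
        mdist x y * (leftover u x / m * leftover v y) =
        (mdist x0 x + mdist x0 y - mdist x y) * (leftover u x / m * leftover v y).
        by ring.
      rewrite mulr_ge0//; last by rewrite !mulr_ge0 ?invr_ge0 ?leftover_ge0// ltW.
      by rewrite subr_ge0 (metric_sym x0 x) metric_triangle.
    rewrite mulr_sumr; apply: ler_sum => i _.
    have -> : mdist x y * (w i * h i x * h i y) = w i * (mdist x y * (h i x * h i y)).
      by ring.
    have -> : 2 * r * w i * h i x * h i y = w i * (2 * r * h i x * h i y) by ring.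
    apply: ler_wpM2l => //.
    apply: (@le_trans _ _ ((mdist (c i) x + mdist (c i) y) * (h i x * h i y))).
      by rewrite ler_wpM2r ?mulr_ge0// (metric_sym _ x) metric_triangle.
    have := ler_wpM2r (h_ge0 i y) (h_r i x); have := ler_wpM2r (h_ge0 i x) (h_r i y).
    lra.
rewrite (EFin_Rintegral_lip nu lB) lee_fin.
rewrite lip_RintegralD//; last by apply: lipschitzZ; exact: lip_leftover.
rewrite lip_RintegralZ ?int_leftover_v ?divfK ?gt_eqF//; last exact: lip_leftover.
rewrite [X in _ + X <= _](lip_Rintegral_comb nu n _ (fun i => 2 * r * w i * h i x)
  (lip_leftover_dist v) lh) -/Sv -[leRHS]addrA lerD2l.
have -> : leftover u x / m * Sv = Sv / m * leftover u x by ring.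
rewrite lerD2l; apply: ler_sum => i _.
by rewrite -/(q i) /u le_eqVlt; apply/orP; left; apply/eqP; ring.
Qed.

(** The kept mass costs at most [2 * r], and the leftovers at most the sum of
    their first moments around [x0]. *)
Lemma transport_estimate :
  (W1 mu nu <= (2 * r + \int[mu]_x leftover_dist u x +
    \int[nu]_x leftover_dist v x)%:E)%E.
Proof.
have d0 (z : XX) : (0 <= (mdist (z.1 : X) (z.2 : X) * dens z)%:E)%E.
  by rewrite lee_fin mulr_ge0 ?mdist_ge0.
have md : measurable_fun setT
    (EFin \o (fun z : XX => mdist (z.1 : X) (z.2 : X) * dens z)).
  by apply/measurable_EFinP/measurable_funM => //; exact: measurable_mdist2 dense_s.
apply: (le_trans (W1_le_density dense_s dens_ge0 measurable_dens dens_nu dens_mu)).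
rewrite (fubini_tonelli1 (EFin \o (fun z : XX => mdist (z.1 : X) (z.2 : X) * dens z)))//.
have lJ1 : lip (fun x => Sv / m * leftover u x +
    \sum_(i < n) 2 * r * u i * h i x).
  exact: (@lipschitz_comb _ _ n _ _ (fun i => 2 * r * u i) _ (lip_leftover u) lh).
have lJ : lip (fun x => leftover_dist u x + (Sv / m * leftover u x +
    \sum_(i < n) 2 * r * u i * h i x)).
  by apply: lipschitzD => //; exact: lip_leftover_dist.
apply: (@le_trans _ _ (\int[mu]_x (leftover_dist u x + (Sv / m * leftover u x +
    \sum_(i < n) 2 * r * u i * h i x))%:E)%E).
  apply: ge0_le_integral => //.
  - by move=> x _; apply: integral_ge0 => y _; exact: (d0 (x, y)).
  - exact: (measurable_fun_fubini_tonelli_F _ md d0).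
  - by apply/measurable_EFinP; exact: lipschitz_measurable lJ.
  - by move=> x _; rewrite addrA; exact: inner_cost.
rewrite (EFin_Rintegral_lip mu lJ) lee_fin.
rewrite lip_RintegralD//; last exact: lip_leftover_dist.
rewrite [X in _ + X <= _](lip_Rintegral_comb mu n _ (fun i => 2 * r * u i)
  (lip_leftover u) lh) int_leftover_u.
rewrite divfK ?gt_eqF//.
have -> : \sum_(i < n) 2 * r * u i * \int[mu]_x h i x = 2 * r * kept.
  by rewrite mulr_sumr; apply: eq_bigr => i _; rewrite /u -/(p i); ring.
have : r * kept <= r by rewrite ler_piMr//; have := m_gt0; rewrite /m; lra.
by rewrite -/Sv; lra.
Qed.

(** The leftover of [nu] is compared with that of [mu] through the integrals
    of the cells, of their products with the distance to [x0], and of this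
    distance: the bound depends on [nu] through [d] only. *)
Lemma W1_le_tests (d : R) : 0 <= d -> (forall i, 0 <= D i) ->
    (forall i, (i < n)%N -> `|\int[nu]_x h i x - \int[mu]_x h i x| <= d) ->
    (forall i, (i < n)%N ->
      `|\int[nu]_x dist_part i x - \int[mu]_x dist_part i x| <= d) ->
    `|\int[nu]_x mdist x0 x - \int[mu]_x mdist x0 x| <= d ->
  (W1 mu nu <= (2 * r +
    2 * (\int[mu]_x mdist x0 x - (1 - eta) * \sum_(i < n) \int[mu]_x dist_part i x) +
    (1 + n%:R + 2 * \sum_(i < n) D i) * d)%:E)%E.
Proof.
move=> d0 D0 qp qphd qpd; apply: (le_trans transport_estimate); rewrite lee_fin.
have /andP[eta0 eta1] := eta01.
rewrite [X in _ + X + _](lip_Rintegral_comb mu n _ (fun i => - u i)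
  (lipschitz_mdist x0) lip_dist_part).
rewrite [X in _ + X <= _](lip_Rintegral_comb nu n _ (fun i => - v i)
  (lipschitz_mdist x0) lip_dist_part).
rewrite !mul1r.
have hdD (m' : P1 X) i :
    0 <= \int[m']_x dist_part i x <= D i * \int[m']_x h i x.
  rewrite Rintegral_ge0 => [|x _]; last by rewrite mulr_ge0 ?mdist_ge0.
  rewrite -lip_RintegralZ//.
  apply: le_lip_Rintegral; [exact: lip_dist_part|exact: lipschitzZ|].
  move=> x; have [hx|/h_D hx] := eqVneq (h i x) 0; first by
    rewrite /dist_part hx mulr0 mul0r.
  by rewrite /dist_part [leRHS]mulrC ler_wpM2l.
have pd i : (i < n)%N -> (- u i) * \int[mu]_x dist_part i x <=
    - ((1 - eta) * \int[mu]_x dist_part i x) + D i * d.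
  move=> ni; have /andP[I0 ID] := hdD mu i.
  have := @kept_mass_defect _ _ _ _ (D i) d eta (p0 i) (q0 i) I0 ID (qp i ni).
  by rewrite eta0 eta1 => /(_ (D0 i) isT); rewrite /u /w; lra.
have qd i : (i < n)%N -> (- v i) * \int[nu]_x dist_part i x <=
    - ((1 - eta) * \int[mu]_x dist_part i x) + (D i * d + d).
  move=> ni; have /andP[I0 ID] := hdD nu i.
  have qp' : `|p i - q i| <= d by rewrite distrC; exact: qp.
  have := @kept_mass_defect _ _ _ _ (D i) d eta (q0 i) (p0 i) I0 ID qp'.
  rewrite eta0 eta1 (maxC (q i)) => /(_ (D0 i) isT); rewrite -/(w i) -/(v i).
  have : (1 - eta) * (\int[mu]_x dist_part i x - \int[nu]_x dist_part i x) <= 1 * d.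
    rewrite (le_trans (ler_norm _))// normrM ler_pM ?normr_ge0//.
      by rewrite ger0_norm; lra.
    by rewrite distrC; exact: qphd.
  lra.
have : \sum_(i < n) - u i * \int[mu]_x dist_part i x <=
    \sum_(i < n) (- ((1 - eta) * \int[mu]_x dist_part i x) + D i * d).
  by apply: ler_sum => i _; exact: pd.
have : \sum_(i < n) - v i * \int[nu]_x dist_part i x <=
    \sum_(i < n) (- ((1 - eta) * \int[mu]_x dist_part i x) + (D i * d + d)).
  by apply: ler_sum => i _; exact: qd.
rewrite !big_split/= !sumrN -!mulr_sumr -!mulr_suml sumr_const card_ord.
rewrite -mulr_natl.
move: qpd; rewrite ler_norml => /andP[_ qpd]; lra.
Qed.

End transport_estimate.

(** * A Lipschitz partition of unity made of small cells *)

Lemma separable_dense_seq (R : realType) (X : completeMetricType R) :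
  separable X ->
  exists s : nat -> X, forall x (e : R), 0 < e -> exists n, mdist x (s n) < e.
Proof.
move=> [A cA dA].
have A0 : A !=set0.
  have [||x [_ Ax]] := dA setT; [by exists point|exact: openT|by exists x].
have /pfcard_geP[A00|[s]] : (A #<= [set: nat])%card by [].
  by move: A0; rewrite A00 => -[].
exists s => x e e0.
have [||y [yb Ay]] := dA (interior (ball x e)).
- by exists x; apply: nbhsx_ballx.
- exact: open_interior.
have [n _ sn] := @surj _ _ _ _ s _ Ay.
by exists n; have := interior_subset yb; rewrite ballEmdist/= sn.
Qed.

Section cutoffs.
Context (R : realType) (X : completeMetricType R) (s : nat -> X) (r : R).
Hypothesis dense_s : forall x (e : R), 0 < e -> exists n, mdist x (s n) < e.
Hypothesis r0 : 0 < r.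
Local Notation lip := (@lipschitz_functions R X).

Definition tent i x := Num.max 0 (1 + - r^-1 * mdist (s i) x).

(** The maximum of the first [n] tents. These functions increase to 1 because
    the centres are dense, and their increments form the partition of unity:
    unlike the quotient of a tent by the sum of all tents, such an increment is
    visibly Lipschitz, and it vanishes where the new tent does. *)
Fixpoint envelope n x :=
  if n is n'.+1 then Num.max (envelope n' x) (tent n' x) else 0.

Definition cutoff n x := envelope n.+1 x - envelope n x.

Lemma tent_le1 i x : tent i x <= 1.
Proof.
by rewrite ge_max ler01 gerDl mulNr oppr_le0 mulr_ge0 ?invr_ge0 ?mdist_ge0// ltW.
Qed.

Lemma envelope_ge0 n x : 0 <= envelope n x.
Proof. by elim: n => //= n IH; rewrite le_max IH. Qed.

Lemma envelope_le1 n x : envelope n x <= 1.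
Proof. by elim: n => /= [|n IH]; rewrite ?ler01// ge_max IH tent_le1. Qed.

Lemma envelope_nd x : {homo envelope^~ x : m n / (m <= n)%N >-> m <= n}.
Proof.
by apply: homo_leq => [//|m n p|n]; [exact: le_trans|rewrite /= le_max lexx].
Qed.

Lemma lip_envelope n : lip (envelope n).
Proof.
elim: n => [|n IH]; first exact: lipschitz_cst.
apply: lipschitz_max => //; apply: lipschitz_max; first exact: lipschitz_cst.
by apply: lipschitzD; [exact: lipschitz_cst|apply/lipschitzZ/lipschitz_mdist].
Qed.

Lemma lip_cutoff n : lip (cutoff n).
Proof.
have -> : cutoff n = (fun x => envelope n.+1 x + -1 * envelope n x).
  by apply/funext => x; rewrite mulN1r.
by apply: lipschitzD; [|apply: lipschitzZ]; exact: lip_envelope.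
Qed.

Lemma cutoff_ge0 n x : 0 <= cutoff n x.
Proof. by rewrite subr_ge0 envelope_nd. Qed.

Lemma cutoff_le1 n x : cutoff n x <= 1.
Proof. by have := envelope_le1 n.+1 x; have := envelope_ge0 n x; rewrite /cutoff; lra. Qed.

Lemma sum_cutoff n x : \sum_(i < n) cutoff i x = envelope n x.
Proof.
elim: n => [|n IH]; first by rewrite big_ord0.
by rewrite big_ord_recr/= IH /cutoff addrC subrK.
Qed.

Lemma cutoff_supp n x : cutoff n x != 0 -> mdist (s n) x <= r.
Proof.
apply: contra_neqT; rewrite -ltNge => rx.
rewrite /cutoff /=; have -> : tent n x = 0.
  apply/max_idPl; rewrite mulNr subr_le0 mulrC ler_pdivlMr ?mul1r//; exact: ltW.
by rewrite (max_idPl (envelope_ge0 n x)) subrr.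
Qed.

Lemma envelope_cvg x : envelope^~ x @ \oo --> (1 : R).
Proof.
apply/cvgrPdist_le => e e0.
have [|i xi] := @dense_s x (e * r); first exact: mulr_gt0.
exists i.+1 => // n /= ni; rewrite ger0_norm ?subr_ge0 ?envelope_le1//.
rewrite lerBlDr -lerBlDl (le_trans _ (envelope_nd x ni))//= le_max.
apply/orP; right; rewrite le_max; apply/orP; right.
rewrite lerD2l mulNr lerN2 mulrC ler_pdivrMr// metric_sym; exact: ltW.
Qed.

(** Dominated convergence, for the products of the distance and [envelope n]. *)
Lemma cutoff_moment_tail (mu : P1 X) (x0 : X) (e : R) : 0 < e ->
  exists n, \int[mu]_x mdist x0 x -
    \sum_(i < n) \int[mu]_x (cutoff i x * mdist x0 x) <= e.
Proof.
move=> e0.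
have ld0 := lipschitz_mdist x0.
have lb i : lip (fun x => cutoff i x * mdist x0 x).
  apply: (@lipschitzM _ _ _ _ (mdist x0 (s i) + r)) => //; first exact: lip_cutoff.
    by move=> x; rewrite ger0_norm ?cutoff_ge0 ?cutoff_le1.
  move=> x /cutoff_supp sx; rewrite ger0_norm ?mdist_ge0//.
  by rewrite (le_trans (metric_triangle _ (s i) _))// lerD2l.
have sumE n x : envelope n x * mdist x0 x = \sum_(i < n) 1 * (cutoff i x * mdist x0 x).
  by rewrite -sum_cutoff mulr_suml; apply: eq_bigr => i _; rewrite mul1r.
have le n : lip (fun x => envelope n x * mdist x0 x).
  under eq_fun do rewrite sumE.
  exact: (@lipschitz_lincomb _ _ n (fun=> 1) _ lb).
have [|||_ _] := @dominated_convergence _ (borel X) R mu setT measurableT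
   (fun n x => (envelope n x * mdist x0 (x : X))%:E) (fun x => (mdist x0 (x : X))%:E)
   (fun x => (mdist x0 (x : X))%:E)
   (fun n => measurable_int _ (lipschitz_integrable mu (le n)))
   (measurable_int _ (lipschitz_integrable mu ld0)).
- apply: aeW => x _; apply: cvg_EFin; first exact: nearW.
  rewrite -[X in _ --> X]mul1r; apply: cvgMr_tmp; exact: envelope_cvg.
- exact: lipschitz_integrable.
- apply: aeW => x n _ /=; rewrite lee_fin normrM !ger0_norm ?mdist_ge0 ?envelope_ge0//.
  by rewrite ler_piMl ?mdist_ge0// envelope_le1.
rewrite (EFin_Rintegral_lip mu ld0) =>
  /fine_cvg /cvgrPdist_le /(_ _ e0)[n _ /(_ n (leqnn n))].
rewrite /= -/(Rintegral _ _ _) => /(le_trans (ler_norm _)) nE; exists n.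
rewrite (le_trans _ nE)//= lerD2l lerN2.
under eq_Rintegral do rewrite sumE.
rewrite (lip_Rintegral_sum mu n (fun=> 1) lb) ler_sum// => i _.
by rewrite mul1r.
Qed.

End cutoffs.

(** * Wasserstein balls and Lipschitz test functions *)

(** The topology of [W1] is no finer than the one generated by the integrals of
    Lipschitz functions. The cells have radius [e / 16], and are numerous enough
    to carry the first moment of [mu] up to [e / 16]. *)
Lemma W1_nbhs_lipschitz (R : realType) (X : completeMetricType R) (mu : P1 X)
    (e : R) : separable X -> 0 < e ->
  exists n (g : nat -> X -> R) (d : R),
    [/\ 0 < d, forall m, lipschitz_functions (g m) & forall nu : P1 X,
      (forall m, (m < n)%N -> `|\int[nu]_x g m x - \int[mu]_x g m x| < d) ->
      (W1 mu nu < e%:E)%E].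
Proof.
move=> /separable_dense_seq[s dense_s] e0.
pose x0 : X := point.
pose a := e / 16; have a0 : 0 < a by rewrite divr_gt0.
pose M := \int[mu]_x mdist x0 x.
have M0 : 0 <= M by apply: Rintegral_ge0 => x _; exact: mdist_ge0.
(* this makes both [eta < 1] and [eta * M <= a] *)
pose eta := a / (M + a + 1).
have den0 : 0 < M + a + 1 by rewrite ltr_wpDl// addr_ge0// ltW.
have eta01 : 0 < eta < 1.
  by rewrite divr_gt0//= ltr_pdivrMr//; lra.
have etaM : eta * M <= a.
  by rewrite mulrAC ler_pdivrMr// ler_wpM2l; lra.
have [n nM] := cutoff_moment_tail dense_s a0 mu x0 a0.
pose h := cutoff s a; pose D i := mdist x0 (s i) + a.
have D0 i : 0 <= D i by rewrite addr_ge0 ?mdist_ge0// ltW.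
have sD : 0 <= \sum_(i < n) D i by exact: sumr_ge0.
have n0 : 0 <= n%:R :> R by exact: ler0n.
pose d := a / (1 + n%:R + 2 * \sum_(i < n) D i).
have d0 : 0 < d by rewrite divr_gt0//; lra.
have hD i x : h i x != 0 -> mdist x0 x <= D i.
  move=> /(cutoff_supp a0) sx.
  by rewrite (le_trans (metric_triangle _ (s i) _))// lerD2l.
have hr i x : h i x * mdist (s i) x <= a * h i x.
  have [->|/(cutoff_supp a0) sx] := eqVneq (h i x) 0; first by rewrite mul0r mulr0.
  by rewrite mulrC ler_wpM2r// cutoff_ge0.
have sum_h x : \sum_(i < n) h i x <= 1 by rewrite sum_cutoff envelope_le1.
(* the tests: the cells, then their products with the distance, then the distance *)
exists (n + n).+1, (fun m => if (m < n)%N then h m else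
  if (m < n + n)%N then dist_part x0 h (m - n) else mdist x0), d.
have lip_part i : lipschitz_functions (dist_part x0 h i).
  apply: (lip_dist_part (D := D)) => //.
  exact: lip_cutoff. exact: cutoff_ge0. exact: cutoff_le1.
split => // [m|nu test].
  case: ifP => _; first exact: lip_cutoff.
  by case: ifP => _ //; exact: lipschitz_mdist.
apply: (@le_lt_trans _ _ (2 * a +
    2 * (M - (1 - eta) * \sum_(i < n) \int[mu]_x dist_part x0 h i x) +
    (1 + n%:R + 2 * \sum_(i < n) D i) * d)%:E).
  apply: (W1_le_tests dense_s (c := s) (h := h)) => //.
  all: try by move=> *; rewrite ?cutoff_ge0 ?cutoff_le1 ?(ltW d0) ?(ltW a0).
  - by move=> i; exact: lip_cutoff.
  - move=> i ni; have := test i; rewrite ni ltnS ltnW ?ltn_addr// => /(_ isT) /ltW.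
    exact.
  - move=> i ni; have := test (n + i)%N.
    by rewrite (ltnNge (n + i) n) leq_addr/= ltn_add2l ni addKn
      ltnS leq_add2l ltnW// => /(_ isT) /ltW.
  - by have := test (n + n)%N; rewrite ltnn (ltnNge (n + n) n) leq_addr/=
      ltnSn => /(_ isT) /ltW.
(* the three terms are at most [2 * a], [4 * a] and [a], where [a = e / 16] *)
have -> : (1 + n%:R + 2 * \sum_(i < n) D i) * d = a.
  by rewrite /d mulrC divfK// gt_eqF//; lra.
set S := \sum_(i < n) _; have {nM} MS : M - S <= a := nM.
have /andP[eta0 eta1] := eta01.
have : (1 - eta) * (M - S) <= (1 - eta) * a by rewrite ler_wpM2l//; lra.
have : (1 - eta) * a <= a by rewrite ler_piMl; lra.
by rewrite lte_fin /a in a0 etaM * => ? ?; lra.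
Qed.

(** * Affine minorants and the duality *)

Section duality.
Context (R : realType) (X : completeMetricType R) (phi : P1 X -> \bar R).
Hypothesis phi_convex : P1_convex phi.
Hypothesis phiNy : forall mu : P1 X, (-oo < phi mu)%E.
Local Notation lip := (@lipschitz_functions R X).

(** The multipliers are taken over the measures where [phi] is finite; elsewhere
    there is nothing to prove. *)
Lemma lipschitz_minorant (mu : P1 X) (a K : R) n (g : nat -> X -> R) : 0 <= K ->
    (forall m, lip (g m)) ->
    (forall nu, (a%:E <= phi nu +
      (K * \sum_(m < n) `|\int[nu]_x g m x - \int[mu]_x g m x|)%:E)%E) ->
  exists2 f, lip f & forall nu : P1 X,
    ((a + (\int[nu]_x f x - \int[mu]_x f x))%:E <= phi nu)%E.
Proof.
move=> K0 lg aK.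
pose D := [set nu | phi nu \is a fin_num].
pose G m (nu : P1 X) := \int[nu]_x g m x - \int[mu]_x g m x.
have [||l hl] := @lagrange_multipliers R (P1 X) D (fun nu => fine (phi nu) - a) n G K K0.
- move=> t i j t01 Di Dj; have /andP[t0 t1] := t01.
  have := phi_convex (Itv01 t0 t1) i j.
  rewrite -(fineK Di) -(fineK Dj) -!EFinM -EFinD/= => cx.
  have Dk : phi (P1_mixture (Itv01 t0 t1) i j) \is a fin_num.
    by rewrite fin_real// phiNy (le_lt_trans cx)// ltry.
  exists (P1_mixture (Itv01 t0 t1) i j) => //; split.
    by move: cx; rewrite -(fineK Dk) lee_fin; lra.
  by move=> m _; rewrite /G Rintegral_mixture//=; lra.
- by move=> nu Dnu; have := aK nu; rewrite -(fineK Dnu) -EFinD lee_fin -subr_ge0 addrAC.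
exists (fun x => \sum_(m < n) - l m * g m x).
  exact: (@lipschitz_lincomb _ _ n (fun m => - l m)).
have int_sum (nu : P1 X) : \int[nu]_x (\sum_(m < n) - l m * g m x) =
    \sum_(m < n) - l m * \int[nu]_x g m x.
  by rewrite (lip_Rintegral_sum _ _ (fun m => - l m)).
move=> nu; rewrite !int_sum -sumrB.
have [Dnu|] := boolP (phi nu \is a fin_num); last first.
  by rewrite fin_numE gt_eqF//= negbK => /eqP ->; rewrite leey.
rewrite -(fineK Dnu) lee_fin; have := hl nu Dnu.
have -> : \sum_(i < n) (- l i * \int[nu]_x g i x - - l i * \int[mu]_x g i x) =
   - \sum_(m < n) l m * G m nu.
  by rewrite -sumrN; apply: eq_bigr => m _; rewrite /G; lra.
lra.
Qed.

Hypothesis sepX : separable X.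
Hypothesis phi_lsc : W1_lower_semicontinuous phi.

Lemma lsc_lipschitz_nbhs (mu : P1 X) (a : R) : (a%:E < phi mu)%E ->
  exists n (g : nat -> X -> R) (d : R), [/\ 0 < d, forall m, lip (g m) &
    forall nu : P1 X,
      \sum_(m < n) `|\int[nu]_x g m x - \int[mu]_x g m x| < d ->
      (a%:E < phi nu)%E].
Proof.
move=> /phi_lsc[e e0 he]; have [n [g [d [d0 lg gd]]]] := W1_nbhs_lipschitz mu sepX e0.
exists n, g, d; split => // nu sd; apply/he/gd => m mn; apply: le_lt_trans sd.
by rewrite (bigD1 (Ordinal mn))//= lerDl sumr_ge0.
Qed.

(** [phi] stays above [a] near [mu]. At a remote [nu], for which the tests add
    up to [s], a value of [phi] below [a - K * s], with
    [K = 2 * (phi mu - a) / d], would by convexity push [phi] below [a] at a point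
    of the segment from [mu] to [nu] which is still near [mu]. *)
Lemma affine_minorant_at_finite (mu : P1 X) (a : R) :
    phi mu \is a fin_num -> (a%:E < phi mu)%E ->
  exists2 f, lip f & forall nu : P1 X,
    ((a + (\int[nu]_x f x - \int[mu]_x f x))%:E <= phi nu)%E.
Proof.
move=> Dmu amu; have [n [g [d [d0 lg low]]]] := lsc_lipschitz_nbhs amu.
have [Di Da] : d != 0 /\ a < fine (phi mu).
  by split; rewrite ?gt_eqF// -lte_fin fineK.
apply: (@lipschitz_minorant mu a (2 * (fine (phi mu) - a) / d) n g) => //.
  by rewrite divr_ge0 ?mulr_ge0 ?subr_ge0 ?ltW.
move=> nu; set s := \sum_(m < n) _.
have s0 : 0 <= s by exact: sumr_ge0.
have [Dnu|] := boolP (phi nu \is a fin_num); last first.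
  by rewrite fin_numE gt_eqF//= negbK => /eqP ->; rewrite addye ?leey.
rewrite -(fineK Dnu) -EFinD lee_fin.
have [sd|ds] := ltP s d.
  have := low nu sd; rewrite -(fineK Dnu) lte_fin => h.
  have : 0 <= 2 * (fine (phi mu) - a) / d * s.
    by rewrite mulr_ge0// divr_ge0 ?mulr_ge0 ?subr_ge0 ?ltW.
  lra.
have sp : 0 < s by lra.
(* with weight [t] on [nu], the mixture is at distance [d / 2] from [mu] for the tests *)
pose t := d / (2 * s).
have ts : t * s = d / 2 by rewrite /t; field; rewrite gt_eqF.
have t0 : 0 <= t by rewrite divr_ge0 ?mulr_ge0// ltW.
have t1 : t <= 1 by rewrite ler_pdivrMr ?mulr_gt0//; lra.
have /low : \sum_(m < n) `|\int[P1_mixture (Itv01 t0 t1) nu mu]_x g m x -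
    \int[mu]_x g m x| < d.
  rewrite (eq_bigr (fun m : 'I_n => t * `|\int[nu]_x g m x - \int[mu]_x g m x|)).
    by rewrite -mulr_sumr ts; lra.
  move=> m _; rewrite -[t in RHS]ger0_norm// -normrM Rintegral_mixture//=.
  by congr normr; ring.
move=> /lt_le_trans /(_ (phi_convex _ _ _)) /=.
rewrite -(fineK Dmu) -(fineK Dnu) -!EFinM -EFinD lte_fin => h.
have -> : 2 * (fine (phi mu) - a) / d * s = (fine (phi mu) - a) / t.
  by rewrite /t; field; rewrite Di gt_eqF.
have tp : 0 < t by rewrite divr_gt0 ?mulr_gt0.
rewrite -lerBlDl ler_pdivlMr//; nra.
Qed.

Hypothesis phi_fin : exists mu0 : P1 X, phi mu0 \is a fin_num.

(** The preceding argument needs [phi mu] to be finite. In general, it provides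
    an affine minorant at some other measure, whose value at [mu] is [b], and
    the linear part [f0] of this minorant is added to the tests. Near [mu],
    [phi] is above [a] anyway. Elsewhere the old tests add up to at least [d],
    and the penalty makes up for the gap between [a] and [b]. *)
Lemma affine_minorant (mu : P1 X) (a : R) : (a%:E < phi mu)%E ->
  exists2 f, lip f & forall nu : P1 X,
    ((a + (\int[nu]_x f x - \int[mu]_x f x))%:E <= phi nu)%E.
Proof.
move=> amu; have [mu0 Dmu0] := phi_fin.
have [|f0 lf0 hf0] := @affine_minorant_at_finite mu0 (fine (phi mu0) - 1) Dmu0.
  by rewrite -[ltRHS](fineK Dmu0) lte_fin; lra.
pose b := fine (phi mu0) - 1 + (\int[mu]_x f0 x - \int[mu0]_x f0 x).
have [n [g [d [d0 lg low]]]] := lsc_lipschitz_nbhs amu.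
pose K := 1 + `|a - b| / d.
have K0 : 0 <= K by rewrite addr_ge0 ?divr_ge0 ?normr_ge0 ?ltW.
apply: (@lipschitz_minorant mu a K n.+1 (fun m => if m == n then f0 else g m)) => //.
  by move=> m; case: ifP.
move=> nu; rewrite big_ord_recr/= eqxx.
rewrite (eq_bigr (fun m : 'I_n => `|\int[nu]_x g m x - \int[mu]_x g m x|)); last first.
  by move=> m _; rewrite ltn_eqF.
set s := \sum_(m < n) _; set s0 := `|_|.
have sp : 0 <= s by exact: sumr_ge0.
have s0p : 0 <= s0 by exact: normr_ge0.
have [Dnu|] := boolP (phi nu \is a fin_num); last first.
  by rewrite fin_numE gt_eqF//= negbK => /eqP ->; rewrite addye ?leey.
rewrite -(fineK Dnu) -EFinD lee_fin.
have [sd|ds] := ltP s d.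
  have := low nu sd; rewrite -(fineK Dnu) lte_fin => h.
  have := mulr_ge0 K0 (addr_ge0 sp s0p); lra.
have := hf0 nu; rewrite -(fineK Dnu) lee_fin => h.
have : s0 <= K * s0 by rewrite ler_peMl// lerDl divr_ge0// ltW.
have : `|a - b| <= K * s.
  rewrite /K mulrDl mul1r ler_wpDl// mulrAC ler_pdivlMr//.
  by rewrite ler_wpM2l.
have := ler_norm (a - b).
have : - s0 <= \int[nu]_x f0 x - \int[mu]_x f0 x by rewrite lerNl /s0 -normrN ler_norm.
rewrite /b mulrDr; lra.
Qed.

(** The Fenchel-Young inequality. *)
Lemma phi_c_le (mu : P1 X) : (phi_c phi mu <= phi mu)%E.
Proof.
apply: ge_ereal_sup => _ [f lf <-].
have rf : (\int[mu]_x (f x)%:E - phi mu <= rho phi f)%E.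
  by apply: ereal_sup_ubound; exists mu.
move: rf; rewrite EFin_Rintegral_lip//.
move: (phiNy mu); case: (phi mu) => [p||]// _; last by rewrite leey.
case: (rho phi f) => [r||]//; rewrite ?addeNy ?leNye//.
by rewrite -!EFinB !lee_fin; lra.
Qed.

Lemma lt_phi_le_phi_c (mu : P1 X) (a : R) : (a%:E < phi mu)%E -> (a%:E <= phi_c phi mu)%E.
Proof.
move=> /affine_minorant[f lf hf].
apply: (@le_trans _ _ (\int[mu]_x (f x)%:E - rho phi f)%E); last first.
  by rewrite /phi_c; apply: ereal_sup_ubound; exists f.
rewrite EFin_Rintegral_lip//.
have : (rho phi f <= (\int[mu]_x f x - a)%:E)%E.
  rewrite /rho; apply: ge_ereal_sup => _ [nu _ <-]; rewrite EFin_Rintegral_lip//.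
  move: (hf nu); case: (phi nu) => [p||]//=; last by rewrite addeNy leNye.
  by rewrite -EFinB !lee_fin; lra.
case: (rho phi f) => [r||]//=; last by rewrite leey.
by rewrite -EFinB !lee_fin; lra.
Qed.

Lemma phi_le_phi_c (mu : P1 X) : (phi mu <= phi_c phi mu)%E.
Proof.
have := @lt_phi_le_phi_c mu; move: (phiNy mu).
case: (phi mu) => [p||]// _; case: (phi_c phi mu) => [c||] h; rewrite ?leey//.
- rewrite lee_fin; apply/ler_addgt0Pl => e e0.
  by have := h (p - e); rewrite lte_fin lee_fin; lra.
- have : ((p - 1)%:E < p%:E)%E by rewrite lte_fin; lra.
  by move=> /h.
- by have := h _ (ltry (c + 1)); rewrite lee_fin gerDl ler10.
- by have := h _ (ltry (0 : R)).
Qed.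

End duality.

Theorem theorem1p1 (R : realType) (X : completeMetricType R)
    (sepX : separable X) (phi : P1 X -> \bar R) (phi_proper : proper_convex phi)
    (mu : P1 X) :
  phi mu = phi_c phi mu.
Proof.
have [phi_convex phi_lsc phiNy phi_fin] := phi_proper.
by apply/le_anti; rewrite phi_c_le// phi_le_phi_c.
Qed.
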